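(* Let $S=\{o_1,\dots,o_n\}$ be a finite set of $n\ge 2$ OIE instances and let $\alpha<\beta$ be real numbers. Then the orbit space of Complete Sequence Addition $$\mathcal O(S,\oplus|_\alpha^\beta)=\big\{\,[r]_\sim : r=\oplus|_\alpha^\beta(o_{i_1},\dots,o_{i_n})\text{ for some index tuple }(i_1,\dots,i_n)\text{ of length }n\,\big\}$$ has exactly one element.
   Context: Times are real numbers; a ''2-tuple'' is a pair $(x,y)$ of reals with $x<y$ (starting and ending timestamp). For a nonempty finite tuple of 2-tuples $T=((x_1,y_1),\dots,(x_m,y_m))$ put $\mathrm{bound}(T)=(\min_i x_i,\max_i y_i)$. An OIE (Optional Intervals Event) instance is a 4-tuple $o=(\mathcal C_o,\mathcal F_o,\mathcal I_o,\mathcal A_o)$ where $\mathcal C_o$ is a finite (possibly empty) tuple of OIE instances, $\mathcal F_o$ is a set of nonempty finite tuples of 2-tuples, $\mathcal I_o=\{\mathrm{bound}(T):T\in\mathcal F_o\}$, and $\mathcal A_o$ is a set of (labels of) atomic events. The void instance is $o_{\mathrm{void}}=((),\emptyset,\emptyset,\emptyset)$; every other instance has $\mathcal F_o,\mathcal I_o,\mathcal A_o$ nonempty. Two instances are equal iff all four components are equal. An index tuple of length $n$ is a tuple in which each of $1,\dots,n$ occurs exactly once. A permutation matrix $M$ acts on $n$-tuples (viewed as row vectors) on the right by reordering the entries, $T\mapsto T\cdot M$. For $S=\{o_1,\dots,o_n\}$ and an index tuple $\sigma=(i_1,\dots,i_n)$, let $N(S,\sigma)=\{(t_1,\dots,t_n):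 t_k\in\mathcal I_{o_{i_k}}\text{ for all }k\}$. External constraints determine an infeasible subset $\mathrm{Inf}(S,\sigma)\subseteq N(S,\sigma)$; this is given data, subject only to the standing axiom: whenever $\sigma\cdot M=\tau$ for index tuples $\sigma,\tau$ of length $n>1$ and a permutation matrix $M$, the map $T\mapsto T\cdot M$ is a bijection from $\mathrm{Inf}(S,\sigma)$ onto $\mathrm{Inf}(S,\tau)$. Put $\mathrm{Feas}(S,\sigma)=N(S,\sigma)\setminus\mathrm{Inf}(S,\sigma)$. Domain filter: for a nonempty set $X$ of $n$-tuples of 2-tuples and reals $\alpha<\beta$, let $X'=\{T\in X: x\ge\alpha\text{ and }y\le\beta\text{ for every entry }(x,y)\text{ of }T\}$. Then $\mathrm{Dom}_\alpha^\beta(X)=X'$ if for every $k\in\{1,\dots,n\}$ some $T\in X'$ has $k$-th entry with first item $\alpha$ and some $T\in X'$ has $k$-th entry with second item $\beta$; otherwise $\mathrm{Dom}_\alpha^\beta(X)=\emptyset$. Complete Sequence Addition $\oplus|_\alpha^\beta(o_{i_1},\dots,o_{i_n})$ ($n\ge2$, $\sigma=(i_1,\dots,i_n)$): the result is $o_{\mathrm{void}}$ if $\bigcap_{k}\mathcal A_{o_{i_k}}\ne\emptyset$, or some $o_{i_k}=o_{\mathrm{void}}$, or $\mathrm{Feas}(S,\sigma)=\emptyset$, or $\mathrm{Dom}_\alpha^\beta(\mathrm{Feas}(S,\sigma))=\emptyset$. Otherwise the result is $(\mathcal C,\mathcal F,\mathcal I,\mathcal A)$ with $\mathcal C=(o_{i_1},\dots,o_{i_n})$,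 $\mathcal F=\mathrm{Dom}_\alpha^\beta(\mathrm{Feas}(S,\sigma))$, $\mathcal I=\{\mathrm{bound}(T):T\in\mathcal F\}$, $\mathcal A=\bigcup_k\mathcal A_{o_{i_k}}$. Permutational equivalence $\sim$: two non-void instances $o,o'$ satisfy $o\sim o'$ if there is a permutation matrix $M$ such that $\mathcal C_o\cdot M=\mathcal C_{o'}$, $T\mapsto T\cdot M$ is a bijection from $\mathcal F_o$ onto $\mathcal F_{o'}$, $\mathcal I_o=\mathcal I_{o'}$ and $\mathcal A_o=\mathcal A_{o'}$. By convention $o_{\mathrm{void}}\sim o_{\mathrm{void}}$, and $o_{\mathrm{void}}$ is equivalent to no non-void instance. $[r]_\sim$ denotes the equivalence class of $r$. *)

(* Defs.v *)
From Stdlib Require List.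
From HB Require Import structures.
From mathcomp Require Import all_boot all_order all_fingroup all_algebra.
From mathcomp Require Import all_classical all_reals.

Set Implicit Arguments.
Unset Strict Implicit.
Unset Printing Implicit Defensive.

Import Order.TTheory GRing.Theory Num.Theory.
Local Open Scope classical_set_scope.
Local Open Scope ring_scope.

(* Right action of an n x n permutation matrix on n-tuples with entries in an
   arbitrary type, where the row-vector product is not available: entry j of
   T . M is the entry of T at the unique row i with M i j = 1.  Only meant for
   permutation matrices; see [permuteE] for agreement with [*m]. *)
Definition permute (n : nat) (X : Type) (M : 'M[int]_n) (T : n.-tuple X) :
    n.-tuple X :=
  [tuple tnth T (odflt j [pick i | M i j == 1]) | j < n].

Lemma permuteE (n : nat) (M : 'M[int]_n) (T : n.-tuple int) :
  is_perm_mx M ->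
  \row_j tnth (permute M T) j = (\row_j tnth T j) *m M.
Proof.
move=> /is_perm_mxP[s ->]; apply/rowP => j.
have Es : perm_mx s = perm_mx (s^-1)^-1%g :> 'M[int]_n by rewrite invgK.
rewrite [in RHS]Es -col_permE !mxE tnth_mktuple.
case: pickP => [i|/(_ (s^-1%g j))]; rewrite !mxE.
  by case: (s i =P j) => [<- _|//] /=; rewrite permK.
by rewrite permKV eqxx.
Qed.

(* The same action on tuples of unspecified length.  A tuple whose length is
   not n, for which T . M makes no sense, is left unchanged; this makes
   [perm_equiv] below reflexive also on instances such as atomic ones, which
   have no components but have nonempty tuples in their second entry. *)
Definition permute_seq (n : nat) (X : Type) (M : 'M[int]_n) (T : seq X) :
    seq X :=
  if insub T is Some t then tval (permute M (t : n.-tuple X)) else T.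

(* Raw 4-tuples (C, F, I, A); L is the type of labels of atomic events.  The
   conditions that make such a 4-tuple an OIE instance are in [is_oie]. *)
Inductive oie (R : realType) (L : Type) : Type :=
  OIE of seq (oie R L) & set (seq (R * R)) & set (R * R) & set L.

Definition comps (R : realType) (L : Type) (o : oie R L) : seq (oie R L) :=
  let: OIE C _ _ _ := o in C.

Definition feasible (R : realType) (L : Type) (o : oie R L) :
    set (seq (R * R)) :=
  let: OIE _ F _ _ := o in F.

Definition intervals (R : realType) (L : Type) (o : oie R L) : set (R * R) :=
  let: OIE _ _ J _ := o in J.

Definition atoms (R : realType) (L : Type) (o : oie R L) : set L :=
  let: OIE _ _ _ A := o in A.

Definition oie_void (R : realType) (L : Type) : oie R L :=
  OIE [::] set0 set0 set0.

(* Meaningful for nonempty T only. *)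
Definition bound (R : realType) (T : seq (R * R)) : R * R :=
  (\big[Num.min/(head (0, 0) T).1]_(t <- T) t.1,
   \big[Num.max/(head (0, 0) T).2]_(t <- T) t.2).

Inductive is_oie (R : realType) (L : Type) : oie R L -> Prop :=
| is_oie_void : is_oie (oie_void R L)
| is_oie_nonvoid (C : seq (oie R L)) (F : set (seq (R * R)))
    (J : set (R * R)) (A : set L) :
    List.Forall (@is_oie R L) C ->
    (forall T, F T -> T <> [::] /\ forall t, t \in T -> t.1 < t.2) ->
    J = [set bound T | T in F] ->
    F !=set0 -> J !=set0 -> A !=set0 ->
    is_oie (OIE C F J A).

(* Indices 1, ..., n are represented by the elements of 'I_n. *)
Definition index_tuple (n : nat) (sigma : n.-tuple 'I_n) : Prop :=
  forall i : 'I_n, count_mem i sigma = 1%N.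

Definition all_tuples (R : realType) (L : Type) (n : nat)
    (o : 'I_n -> oie R L) (sigma : n.-tuple 'I_n) : set (n.-tuple (R * R)) :=
  [set T | forall k : 'I_n, intervals (o (tnth sigma k)) (tnth T k)].

(* The standing assumptions on the infeasible subsets Inf(S, sigma), for the
   given S = {o_1, ..., o_n}; values of Inf at tuples that are not index
   tuples are irrelevant. *)
Definition infeasibility_axiom (R : realType) (L : Type) (n : nat)
    (o : 'I_n -> oie R L) (Inf : n.-tuple 'I_n -> set (n.-tuple (R * R))) :
    Prop :=
  (forall sigma, index_tuple sigma -> Inf sigma `<=` all_tuples o sigma) /\
  (forall (sigma tau : n.-tuple 'I_n) (M : 'M[int]_n),
     (1 < n)%N -> index_tuple sigma -> index_tuple tau -> is_perm_mx M ->
     permute M sigma = tau ->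
     set_bij (Inf sigma) (Inf tau) (permute M)).

Definition feas (R : realType) (L : Type) (n : nat) (o : 'I_n -> oie R L)
    (Inf : n.-tuple 'I_n -> set (n.-tuple (R * R))) (sigma : n.-tuple 'I_n) :
    set (n.-tuple (R * R)) :=
  all_tuples o sigma `\` Inf sigma.

Definition within (R : realType) (n : nat) (alpha beta : R)
    (X : set (n.-tuple (R * R))) : set (n.-tuple (R * R)) :=
  [set T | X T /\
     forall k : 'I_n, alpha <= (tnth T k).1 /\ (tnth T k).2 <= beta].

Definition domain_filter (R : realType) (n : nat) (alpha beta : R)
    (X : set (n.-tuple (R * R))) : set (n.-tuple (R * R)) :=
  let X' := within alpha beta X in
  if `[< forall k : 'I_n,
           (exists2 T, X' T & (tnth T k).1 = alpha) /\
           (exists2 T, X' T & (tnth T k).2 = beta) >]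
  then X' else set0.

(* Complete Sequence Addition of (o_{i_1}, ..., o_{i_n}), where
   sigma = (i_1, ..., i_n). *)
Definition seq_add (R : realType) (L : Type) (n : nat) (o : 'I_n -> oie R L)
    (Inf : n.-tuple 'I_n -> set (n.-tuple (R * R))) (alpha beta : R)
    (sigma : n.-tuple 'I_n) : oie R L :=
  let D := domain_filter alpha beta (feas o Inf sigma) in
  let F := [set tval T | T in D] in
  if `[< [\/ \bigcap_(k : 'I_n) atoms (o (tnth sigma k)) <> set0,
             exists k : 'I_n, o (tnth sigma k) = oie_void R L,
             feas o Inf sigma = set0 |
             D = set0] >]
  then oie_void R L
  else OIE [seq o i | i <- sigma] F [set bound T | T in F]
           (\bigcup_(k : 'I_n) atoms (o (tnth sigma k))).

Lemma is_oie_seq_add (R : realType) (L : Type) (n : nat) (o : 'I_n -> oie R L)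
    (Inf : n.-tuple 'I_n -> set (n.-tuple (R * R))) (alpha beta : R)
    (sigma : n.-tuple 'I_n) :
  (0 < n)%N -> (forall i, is_oie (o i)) ->
  is_oie (seq_add o Inf alpha beta sigma).
Proof.
move=> n_gt0 oI; rewrite /seq_add; case: asboolP => [_|H].
  exact: is_oie_void.
have bound_lt (T : seq (R * R)) : T <> [::] ->
    (forall t, t \in T -> t.1 < t.2) -> (bound T).1 < (bound T).2.
  case: T => // t T _ tlt; apply: (@le_lt_trans _ _ t.1) => /=.
    by rewrite big_cons ge_min lexx.
  apply: (lt_le_trans (tlt t (mem_head _ _))).
  by rewrite big_cons le_max lexx.
have [T0 DT0] : domain_filter alpha beta (feas o Inf sigma) !=set0.
  by apply/set0P/eqP => D0; apply: H; apply: Or44.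
apply: is_oie_nonvoid.
- elim: (tval sigma) => [|i s IHs] /=; first exact: List.Forall_nil.
  exact: List.Forall_cons.
- move=> _ [T DT <-]; split.
    by move/(congr1 size); rewrite size_tuple => n0; rewrite n0 in n_gt0.
  move=> t /tnthP[k ->].
  have : intervals (o (tnth sigma k)) (tnth T k).
    move: DT; rewrite /domain_filter /=; case: asboolP => // _ [[+ _] _].
    exact.
  case: (oI (tnth sigma k)) => //= C F J A _ FT -> _ _ _ [U FU <-].
  by have [U0 Ult] := FT _ FU; apply: bound_lt.
- by [].
- by exists (tval T0), T0.
- by exists (bound T0), (tval T0) => //; exists T0.
- have k0 : 'I_n := Ordinal n_gt0.
  have : o (tnth sigma k0) <> oie_void R L.
    by move=> o0; apply: H; apply: Or42; exists k0.
  suff A0 : o (tnth sigma k0) <> oie_void R L ->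
      atoms (o (tnth sigma k0)) !=set0.
    by move=> /A0[a Aa]; exists a, k0.
  by case: (oI (tnth sigma k0)).
Qed.

Definition perm_equiv (R : realType) (L : Type) (o o' : oie R L) : Prop :=
  (o = oie_void R L /\ o' = oie_void R L) \/
  [/\ o <> oie_void R L, o' <> oie_void R L &
      exists M : 'M[int]_(size (comps o)),
        [/\ is_perm_mx M,
            permute_seq M (comps o) = comps o',
            set_bij (feasible o) (feasible o') (permute_seq M),
            intervals o = intervals o' &
            atoms o = atoms o']].

Definition equiv_class (R : realType) (L : Type) (r : oie R L) :
    set (oie R L) :=
  [set o | is_oie o /\ perm_equiv r o].

Definition orbit_space (R : realType) (L : Type) (n : nat)
    (o : 'I_n -> oie R L) (Inf : n.-tuple 'I_n -> set (n.-tuple (R * R)))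
    (alpha beta : R) : set (set (oie R L)) :=
  [set c | exists2 sigma : n.-tuple 'I_n, index_tuple sigma &
             c = equiv_class (seq_add o Inf alpha beta sigma)].

(* Main.v *)
Require Import Defs.
From HB Require Import structures.
From mathcomp Require Import all_boot all_order all_fingroup all_algebra.
From mathcomp Require Import all_classical all_reals.

Import Order.TTheory GRing.Theory Num.Theory.
Local Open Scope classical_set_scope.
Local Open Scope ring_scope.

(** Any two index tuples of length [n] are rearrangements of one another, say
    [tau = sigma . M].  Every ingredient of Complete Sequence Addition is either
    carried by [M] from [sigma] to [tau] -- all tuples, infeasible tuples
    (this is the standing axiom), hence feasible tuples, hence the output of the
    domain filter -- or insensitive to the order of the operands: the
    intersection and union of the sets of atoms, the presence of a void operand,
    and the bound of a tuple.  So the two sums are void together, and otherwise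
    [M] itself witnesses that they are permutationally equivalent
    ([seq_add_equiv]).

    Since [perm_equiv] is symmetric and transitive ([perm_equiv_sym],
    [perm_equiv_trans]), equivalent sums have equal classes, so all index tuples
    contribute the same class; the identity tuple shows that there is one. *)

(** * The action of permutation matrices on tuples *)

Lemma tnth_permute_perm_mx (n : nat) (X : Type) (s : 'S_n) (T : n.-tuple X) j :
  tnth (permute (perm_mx s) T) j = tnth T (s^-1%g j).
Proof.
rewrite tnth_mktuple; case: pickP => [i|/(_ (s^-1%g j))]; rewrite !mxE.
  by case: (s i =P j) => [<- _|//] /=; rewrite permK.
by rewrite permKV eqxx.
Qed.

Lemma tnth_permute_perm_mxK (n : nat) (X : Type) (s : 'S_n) (T : n.-tuple X) k :
  tnth (permute (perm_mx s) T) (s k) = tnth T k.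
Proof. by rewrite tnth_permute_perm_mx permK. Qed.

Lemma permute_perm_mxM (n : nat) (X : Type) (s t : 'S_n) (T : n.-tuple X) :
  permute (perm_mx t) (permute (perm_mx s) T) = permute (perm_mx (s * t)%g) T.
Proof. by apply: eq_from_tnth => j; rewrite !tnth_permute_perm_mx invMg permM. Qed.

Lemma permute_perm_mx1 (n : nat) (X : Type) (T : n.-tuple X) :
  permute (perm_mx 1%g) T = T.
Proof.
by apply: eq_from_tnth => j; rewrite tnth_permute_perm_mx invg1 perm1.
Qed.

Lemma permute_perm_mxK (n : nat) (X : Type) (s : 'S_n) :
  cancel (@permute n X (perm_mx s)) (permute (perm_mx s^-1%g)).
Proof. by move=> T; rewrite permute_perm_mxM mulgV permute_perm_mx1. Qed.

Lemma permute_perm_mxKV (n : nat) (X : Type) (s : 'S_n) :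
  cancel (@permute n X (perm_mx s^-1%g)) (permute (perm_mx s)).
Proof. by move=> T; rewrite permute_perm_mxM mulVg permute_perm_mx1. Qed.

Lemma perm_eq_permute (n : nat) (X : eqType) (s : 'S_n) (T : n.-tuple X) :
  perm_eq (permute (perm_mx s) T) T.
Proof.
apply/tuple_permP; exists s^-1%g; congr tval.
by apply: eq_from_tnth => j; rewrite tnth_permute_perm_mx tnth_mktuple.
Qed.

Lemma map_permute (n : nat) (X Y : Type) (f : X -> Y) (s : 'S_n)
    (T : n.-tuple X) :
  permute (perm_mx s) [tuple of map f T] = [tuple of map f (permute (perm_mx s) T)].
Proof.
by apply: eq_from_tnth => j; rewrite !(tnth_permute_perm_mx, tnth_map).
Qed.

Lemma permute_seq_tuple (n : nat) (X : Type) (M : 'M[int]_n) (T : n.-tuple X) :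
  permute_seq M T = permute M T :> seq X.
Proof. by rewrite /permute_seq valK. Qed.

Lemma permute_seq_perm_mxM (n : nat) (X : Type) (s t : 'S_n) (T : seq X) :
  permute_seq (perm_mx t) (permute_seq (perm_mx s) T) =
  permute_seq (perm_mx (s * t)%g) T.
Proof.
rewrite {2 3}/permute_seq; case: insubP => [u _ _|/negbTE Tn].
  by rewrite permute_seq_tuple permute_perm_mxM.
by rewrite /permute_seq; case: insubP => // u; rewrite Tn.
Qed.

Lemma permute_seq_perm_mx1 (n : nat) (X : Type) (T : seq X) :
  permute_seq (perm_mx (1%g : 'S_n)) T = T.
Proof.
rewrite /permute_seq; case: insubP => // u _ <-.
by rewrite permute_perm_mx1.
Qed.

Lemma permute_seq_perm_mxK (n : nat) (X : Type) (s : 'S_n) :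
  cancel (@permute_seq n X (perm_mx s)) (permute_seq (perm_mx s^-1%g)).
Proof. by move=> T; rewrite permute_seq_perm_mxM mulgV permute_seq_perm_mx1. Qed.

Lemma size_permute_seq (n : nat) (X : Type) (M : 'M[int]_n) (T : seq X) :
  size (permute_seq M T) = size T.
Proof.
rewrite /permute_seq; case: insubP => // u _ <-.
by rewrite !size_tuple.
Qed.

Lemma index_tuple_permute (n : nat) (sigma tau : n.-tuple 'I_n) :
  index_tuple sigma -> index_tuple tau ->
  exists s : 'S_n, permute (perm_mx s) sigma = tau.
Proof.
move=> sigmaI tauI.
have /tuple_permP[p Ep] : perm_eq tau sigma.
  by apply/allP => i _; rewrite /= sigmaI tauI.
exists p^-1%g; apply: val_inj; rewrite [RHS]Ep; congr tval.
by apply: eq_from_tnth => j; rewrite tnth_permute_perm_mx invgK tnth_mktuple.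
Qed.

(** * Permutational equivalence *)

(** The size of the matrix in [perm_equiv] is [size (comps o)], a term that
    differs from one instance to the next; with a free size and an equation in
    its place, matrices that come from different instances can be composed. *)
Lemma perm_equiv_intro (R : realType) (L : Type) (n : nat) (s : 'S_n)
    (o o' : oie R L) :
  o <> oie_void R L -> o' <> oie_void R L -> size (comps o) = n ->
  permute_seq (perm_mx s) (comps o) = comps o' ->
  set_bij (feasible o) (feasible o') (permute_seq (perm_mx s)) ->
  intervals o = intervals o' -> atoms o = atoms o' ->
  perm_equiv o o'.
Proof.
move=> o0 o'0 En; case: _ / En s => s EC bF EJ EA; right; split=> //.
by exists (perm_mx s); split=> //; apply: perm_mx_is_perm.
Qed.

Lemma perm_equiv_sym (R : realType) (L : Type) (o o' : oie R L) :
  perm_equiv o o' -> perm_equiv o' o.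
Proof.
case=> [[-> ->]|[o0 o'0 [_ [/is_perm_mxP[s ->] EC bF EJ EA]]]]; first by left.
apply: (@perm_equiv_intro _ _ (size (comps o)) s^-1%g) => //.
- by rewrite -EC size_permute_seq.
- by rewrite -EC permute_seq_perm_mxK.
case: bF => fF _ sF; split.
- move=> _ /sF[T FT <-]; by rewrite permute_seq_perm_mxK.
- apply: in2W; apply: can_inj (permute_seq (perm_mx s)) _ => T.
  by rewrite -{1}[s]invgK permute_seq_perm_mxK.
- move=> T FT; exists (permute_seq (perm_mx s) T); first exact: fF.
  exact: permute_seq_perm_mxK.
Qed.

Lemma perm_equiv_trans (R : realType) (L : Type) (o2 o1 o3 : oie R L) :
  perm_equiv o1 o2 -> perm_equiv o2 o3 -> perm_equiv o1 o3.
Proof.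
case=> [[-> ->] //|[o10 o20 [_ [/is_perm_mxP[s ->] EC bF EJ EA]]]].
case=> [[]//|[_ o30 [M [MP EC' bF' EJ' EA']]]].
have En : size (comps o2) = size (comps o1) by rewrite -EC size_permute_seq.
move: M MP EC' bF'; rewrite En => _ /is_perm_mxP[t ->] EC' bF'.
have Est : permute_seq (perm_mx t) \o permute_seq (perm_mx s) =
    @permute_seq _ (R * R) (perm_mx (s * t)%g).
  by apply/funext => T /=; rewrite permute_seq_perm_mxM.
apply: (@perm_equiv_intro _ _ (size (comps o1)) (s * t)%g) => //.
- by rewrite -permute_seq_perm_mxM EC.
- rewrite -Est; exact: set_bij_comp bF bF'.
- by rewrite EJ.
- by rewrite EA.
Qed.

Lemma equiv_class_eq (R : realType) (L : Type) (r r' : oie R L) :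
  perm_equiv r r' -> Defs.equiv_class r = Defs.equiv_class r'.
Proof.
move=> rr'; apply/seteqP; split=> q [qI rq]; split=> //.
  exact: perm_equiv_trans (perm_equiv_sym _ _ _ _ rr') rq.
exact: perm_equiv_trans rr' rq.
Qed.

(** * Invariance of Complete Sequence Addition *)

(** The default value in [bound], the head of the tuple, does depend on the
    order of the entries; it is harmless because it is itself an entry. *)
Lemma perm_bound (R : realType) (T U : seq (R * R)) :
  perm_eq T U -> bound T = bound U.
Proof.
suff le_bound (V W : seq (R * R)) : perm_eq V W ->
    (bound V).1 <= (bound W).1 /\ (bound W).2 <= (bound V).2.
  move=> TU; have [le1 le2] := le_bound _ _ TU.
  have [ge1 ge2] : (bound U).1 <= (bound T).1 /\ (bound T).2 <= (bound U).2.
    by apply: le_bound; rewrite perm_sym.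
  by apply/pair_equal_spec; split; apply/le_anti/andP; split.
move=> VW; have [V0|Vn0] := eqVneq V [::].
  by move: VW; rewrite V0 perm_sym => /perm_nilP ->.
have hW : head (0, 0) W \in V.
  rewrite (perm_mem VW); case: W VW => [/perm_nilP V0|w W _].
    by rewrite V0 in Vn0.
  exact: mem_head.
split=> /=.
  rewrite [leRHS]big_seq; apply: (big_ind (fun x => _ <= x)) => [|x y lx ly|t tW].
  - exact: (@ge_bigmin_seq _ _ _ _ _ (head (0, 0) W) predT fst).
  - by rewrite le_min lx ly.
  - by apply: (@ge_bigmin_seq _ _ _ _ _ t predT fst); rewrite // (perm_mem VW).
rewrite [leLHS]big_seq; apply: (big_ind (fun x => x <= _)) => [|x y lx ly|t tW].
- exact: (@Order.TotalTheory.le_bigmax_seq _ _ _ _ _ (head (0, 0) W) predT snd).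
- by rewrite ge_max lx ly.
- apply: (@Order.TotalTheory.le_bigmax_seq _ _ _ _ _ t predT snd) => //.
  by rewrite (perm_mem VW).
Qed.

Lemma all_tuples_permute (R : realType) (L : Type) (n : nat)
    (o : 'I_n -> oie R L) (s : 'S_n) (sigma : n.-tuple 'I_n) T :
  all_tuples o (permute (perm_mx s) sigma) (permute (perm_mx s) T) <->
  all_tuples o sigma T.
Proof.
split=> H k; last by rewrite !tnth_permute_perm_mx; apply: H.
by have := H (s k); rewrite !tnth_permute_perm_mxK.
Qed.

(** The axiom makes the action map the infeasible tuples for one index tuple
    onto those for the other; as the action is injective on all tuples, nothing
    else lands there, so that the complements correspond as well. *)
Lemma feas_permute (R : realType) (L : Type) (n : nat) (o : 'I_n -> oie R L)
    (Inf : n.-tuple 'I_n -> set (n.-tuple (R * R))) (s : 'S_n)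
    (sigma : n.-tuple 'I_n) T :
  (1 < n)%N -> infeasibility_axiom o Inf -> index_tuple sigma ->
  index_tuple (permute (perm_mx s) sigma) ->
  feas o Inf (permute (perm_mx s) sigma) (permute (perm_mx s) T) <->
  feas o Inf sigma T.
Proof.
move=> n_gt1 [_ InfP] sI tI.
have [fI _ sInf] := InfP _ _ _ n_gt1 sI tI (perm_mx_is_perm _ s) erefl.
split=> [[/all_tuples_permute aT nI]|[aT nI]]; split=> //.
- by move=> /fI.
- exact/all_tuples_permute.
- by move=> /sInf[U IU /(can_inj (permute_perm_mxK _ _ s)) UT]; rewrite -UT in nI.
Qed.

(** Two sets of tuples that correspond under the action are described below by
    an equivalence rather than as an image: this form passes through set
    difference and through the filter pointwise, and the image is recovered from
    the surjectivity of the action. *)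
Lemma image_permute (R : realType) (n : nat) (s : 'S_n)
    (X Y : set (n.-tuple (R * R))) :
  (forall T, Y (permute (perm_mx s) T) <-> X T) ->
  Y = permute (perm_mx s) @` X.
Proof.
move=> XY; apply/seteqP; split=> [T YT|_ [T /XY YT <-] //].
exists (permute (perm_mx s^-1%g) T); last exact: permute_perm_mxKV.
by apply/XY; rewrite permute_perm_mxKV.
Qed.

Lemma set0_permute (R : realType) (n : nat) (s : 'S_n)
    (X Y : set (n.-tuple (R * R))) :
  (forall T, Y (permute (perm_mx s) T) <-> X T) ->
  Y = set0 <-> X = set0.
Proof.
move=> XY; split=> E0; last by rewrite (image_permute _ _ _ _ _ XY) E0 image_set0.
by rewrite -subset0 => T /XY; rewrite E0.
Qed.

Lemma within_permute (R : realType) (n : nat) (s : 'S_n)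
    (X Y : set (n.-tuple (R * R))) (alpha beta : R) T :
  (forall T, Y (permute (perm_mx s) T) <-> X T) ->
  Defs.within alpha beta Y (permute (perm_mx s) T) <-> Defs.within alpha beta X T.
Proof.
move=> XY; split=> [[/XY XT ab]|[/XY YT ab]]; split=> // k.
  by have := ab (s k); rewrite tnth_permute_perm_mxK.
by rewrite tnth_permute_perm_mx.
Qed.

(** The filter asks for the endpoints [alpha] and [beta] at every position, a
    requirement that a rearrangement of the positions leaves unchanged. *)
Lemma domain_filter_permute (R : realType) (n : nat) (s : 'S_n)
    (X Y : set (n.-tuple (R * R))) (alpha beta : R) T :
  (forall T, Y (permute (perm_mx s) T) <-> X T) ->
  domain_filter alpha beta Y (permute (perm_mx s) T) <->
  domain_filter alpha beta X T.
Proof.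
move=> XY; have XY' U := within_permute _ _ _ _ _ alpha beta U XY.
rewrite /domain_filter /=; case: asboolP => HY; case: asboolP => HX //.
- split=> // _; apply: HX => k.
  have [[U YU U1] [V YV V2]] := HY (s k); split.
    exists (permute (perm_mx s^-1%g) U).
      by apply/XY'; rewrite permute_perm_mxKV.
    by rewrite tnth_permute_perm_mx invgK.
  exists (permute (perm_mx s^-1%g) V).
    by apply/XY'; rewrite permute_perm_mxKV.
  by rewrite tnth_permute_perm_mx invgK.
- split=> // _; apply: HY => k.
  have [[U XU U1] [V XV V2]] := HX (s^-1%g k); split.
    exists (permute (perm_mx s) U); first exact/XY'.
    by rewrite tnth_permute_perm_mx.
  exists (permute (perm_mx s) V); first exact/XY'.
  by rewrite tnth_permute_perm_mx.
Qed.

(** The matrix that rearranges the index tuple is also the one that witnesses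
    the equivalence of the sums: it acts in the same way on the components and
    on the filtered feasible tuples, and the remaining data do not depend on the
    order. *)
Lemma seq_add_equiv (R : realType) (L : Type) (n : nat) (o : 'I_n -> oie R L)
    (Inf : n.-tuple 'I_n -> set (n.-tuple (R * R))) (alpha beta : R)
    (s : 'S_n) (sigma : n.-tuple 'I_n) :
  (1 < n)%N -> infeasibility_axiom o Inf -> index_tuple sigma ->
  index_tuple (permute (perm_mx s) sigma) ->
  perm_equiv (seq_add o Inf alpha beta sigma)
             (seq_add o Inf alpha beta (permute (perm_mx s) sigma)).
Proof.
move=> n_gt1 InfP sI tI; set tau := permute _ sigma.
have FE T := feas_permute _ _ _ o Inf s sigma T n_gt1 InfP sI tI.
have DE T := domain_filter_permute _ _ s _ _ alpha beta T FE.
rewrite /seq_add -/tau.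
set DX := domain_filter _ _ (feas o Inf sigma) in DE *.
set DY := domain_filter _ _ _ in DE *.
have capE : \bigcap_k atoms (o (tnth tau k)) =
    \bigcap_k atoms (o (tnth sigma k)).
  apply/seteqP; split=> a Ha k _.
    by have := Ha (s k) I; rewrite tnth_permute_perm_mxK.
  by rewrite tnth_permute_perm_mx; apply: Ha.
have cupE : \bigcup_k atoms (o (tnth tau k)) =
    \bigcup_k atoms (o (tnth sigma k)).
  apply/seteqP; split=> a [k _ Ha].
    by exists (s^-1%g k) => //; rewrite -tnth_permute_perm_mx.
  by exists (s k) => //; rewrite tnth_permute_perm_mxK.
have voidE : (exists k, o (tnth tau k) = oie_void R L) <->
    (exists k, o (tnth sigma k) = oie_void R L).
  split=> -[k ok].
    by exists (s^-1%g k); rewrite -tnth_permute_perm_mx.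
  by exists (s k); rewrite tnth_permute_perm_mxK.
rewrite capE cupE (propext voidE) (propext (set0_permute _ _ _ _ _ FE)).
rewrite (propext (set0_permute _ _ _ _ _ DE)).
case: asboolP => [_|_]; first by left.
have DYE := image_permute _ _ _ _ _ DE.
have Etau : tau = permute (perm_mx s) sigma by [].
clearbody tau.
(* A sum with n >= 2 components differs from the void instance in its first
   entry. *)
have nonvoid (rho : n.-tuple 'I_n) F J A :
    OIE [seq o i | i <- rho] F J A <> oie_void R L.
  case=> /(congr1 size); rewrite size_map size_tuple => n0 _ _ _.
  by rewrite n0 in n_gt1.
apply: (@perm_equiv_intro _ _ n s) => //=.
- by rewrite size_map size_tuple.
- rewrite -[map o sigma]/(tval [tuple of map o sigma]) permute_seq_tuple.
  by rewrite map_permute -Etau.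
- split.
  + move=> _ [T DT <-]; rewrite permute_seq_tuple.
    by exists (permute (perm_mx s) T) => //; apply/DE.
  + exact: in2W (can_inj (permute_seq_perm_mxK _ _ s)).
  + move=> _ [_ /[!DYE] -[T DT <-] <-].
    exists (tval T); first by exists T.
    exact: permute_seq_tuple.
- rewrite DYE !image_comp; apply: eq_imagel => T _ /=.
  by apply: perm_bound; rewrite perm_sym perm_eq_permute.
Qed.

Theorem mainTheorem6 (R : realType) (L : Type) (n : nat)
    (o : 'I_n -> oie R L)
    (Inf : n.-tuple 'I_n -> set (n.-tuple (R * R)))
    (alpha beta : R) :
  (2 <= n)%N ->
  injective o ->
  (forall i, is_oie (o i)) ->
  infeasibility_axiom o Inf ->
  alpha < beta ->
  exists c : set (oie R L), orbit_space o Inf alpha beta = [set c].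
Proof.
move=> n_gt1 _ _ InfP _.
have iI : index_tuple (ord_tuple n).
  by move=> i; rewrite val_ord_tuple count_uniq_mem ?enum_uniq ?mem_enum.
exists (Defs.equiv_class (seq_add o Inf alpha beta (ord_tuple n))).
apply/seteqP; split=> [_ [sigma sI ->]|_ ->] /=; last by exists (ord_tuple n).
have [s Es] := index_tuple_permute _ _ _ iI sI.
rewrite -Es in sI *; apply/esym/equiv_class_eq.
exact: seq_add_equiv.
Qed.
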